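(* Let $(v_0,v)\in\mathbb{R}\times\mathbb{R}^n$ be such that $\mathrm{E\text{-}CG}(v_0,v)\in\mathcal{F}_2$ via these parameters, i.e. $v_i^2\in\mathbb{Z}$ for all $i$, $2v_iv_j\in\mathbb{Z}$ for all $i\neq j$, and $2v_iv_0\in\mathbb{Z}$ for all $i$, and suppose $\|v\|_0\ge 2$, where $\|v\|_0$ is the number of nonzero entries of $v$. Let $\hat x\in\mathbb{R}^n$ and let $\hat X$ be a real symmetric $n\times n$ matrix such that $(\hat x,\hat X)\notin\mathrm{QPB}_n$, and suppose that $(\hat x,\hat X)$ satisfies the SDP constraint $$\begin{bmatrix}1&\hat x^{\top}\\ \hat x&\hat X\end{bmatrix}\succeq 0$$ and the McCormick inequalities $\hat X_{i,j}\le \hat x_i$, $\hat X_{i,j}\le\hat x_j$, $\hat X_{i,j}\ge 0$, $\hat X_{i,j}\ge\hat x_i+\hat x_j-1$ for all $i\neq j$ in $\{1,\dots,n\}$. Then the maximum violation (depth of cut) of $(\hat x,\hat X)$ for the inequality $\mathrm{E\text{-}CG}(v_0,v)$ is at most $$\frac{1}{\sqrt{\|v\|_0-1}\cdot\|v\|_2}.$$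
   Context: $\mathrm{QPB}_n=\operatorname{conv}\{(x,X)\in[0,1]^{n+\binom{n+1}{2}} : X_{i,j}=x_ix_j,\ 1\le i\le j\le n\}$; a symmetric matrix $X$ is identified with its entries $(X_{i,j})_{1\le i\le j\le n}$. For $v_0\in\mathbb{R}$, $v\in\mathbb{R}^n$, $\mathrm{E\text{-}CG}(v_0,v)=(\alpha,\beta,\gamma)$ with $\alpha_i=\lceil v_i^2+2v_iv_0\rceil$ for $i\in\{1,\dots,n\}$, $\beta_{ij}=\lceil 2v_iv_j\rceil$ for $1\le i<j\le n$, $\gamma=\lfloor v_0^2\rfloor$, representing the inequality $\sum_{i<j}\beta_{ij}X_{i,j}+\sum_i\alpha_ix_i+\gamma\ge0$. $\mathcal{F}_2=\{\mathrm{E\text{-}CG}(v_0,v): v_i^2\in\mathbb{Z}\ \forall i,\ 2v_iv_j\in\mathbb{Z}\ \forall i\ne j,\ 2v_iv_0\in\mathbb{Z}\ \forall i\}$. The depth (violation) of a cut $a^{\top}z\le b$ at a point $z^*$ is $(a^{\top}z^*-b)/\|a\|_2$. For the inequality $\mathrm{E\text{-}CG}(v_0,v)$ at $(\hat x,\hat X)$ this is $$\frac{-\gamma-\sum_{i<j}\beta_{ij}\hat X_{i,j}-\sum_i\alpha_i\hat x_i}{\sqrt{\sum_{i<j}\beta_{ij}^2+\sum_i\alpha_i^2}}.$$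
   Formalization: The formal theorem also assumes the diagonal McCormick inequality X_ii ≤ x_i for all i; without it the claim fails, e.g. n=3, v=(4,4,4), v_0=-6, x=(1/2,1/2,1/2), X=I has depth 12/√6144 > 1/√96. *)

(* Defs.v *)
(* MathComp / MathComp-Analysis: the reals are an arbitrary R : realType. *)
From HB Require Import structures.
From mathcomp Require Import all_boot all_order all_algebra.
From mathcomp Require Import classical_sets reals.
Set Implicit Arguments.
Unset Strict Implicit.
Unset Printing Implicit Defensive.
Import Order.TTheory GRing.Theory Num.Theory.
Local Open Scope classical_set_scope.
Local Open Scope ring_scope.

Definition convex_hull (R : realType) (V : lmodType R) (A : set V) : set V :=
  [set z | exists (k : nat) (w : 'I_k -> R) (p : 'I_k -> V),
    [/\ forall i, 0 <= w i, \sum_i w i = 1, forall i, A (p i)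
      & z = \sum_i w i *: p i]].

(* The entries (X_ij)_(i <= j) are carried by a symmetric matrix X; for the
   points below symmetry follows from X_ij = x_i x_j, and it passes to the
   convex hull. *)
Definition QPB (R : realType) (n : nat) : set ('cV[R]_n * 'M[R]_n)%type :=
  convex_hull [set z : 'cV[R]_n * 'M[R]_n |
    [/\ forall i, 0 <= z.1 i 0 <= 1, forall i j, 0 <= z.2 i j <= 1
      & forall i j, z.2 i j = z.1 i 0 * z.1 j 0]].

Definition psdmx (R : realType) (n : nat) (A : 'M[R]_n) : Prop :=
  A \is symmetricmx /\ forall u : 'cV[R]_n, 0 <= (u^T *m A *m u) 0 0.

Definition sdp_constraint (R : realType) (n : nat)
    (x : 'cV[R]_n) (X : 'M[R]_n) : Prop :=
  psdmx (block_mx (1%:M : 'M[R]_1) x^T x X).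

(* At i = j these reduce to X_ii <= x_i, 0 <= X_ii and 2 x_i - 1 <= X_ii, the
   last two of which already follow from the SDP constraint. Off the diagonal
   they put no upper bound on X_ii. *)
Definition mccormick (R : realType) (n : nat) (x : 'cV[R]_n) (X : 'M[R]_n)
    (i j : 'I_n) : Prop :=
  [/\ X i j <= x i 0, X i j <= x j 0, 0 <= X i j & x i 0 + x j 0 - 1 <= X i j].

(* The triple (alpha, beta, gamma) stands for the inequality
     \sum_(i < j) beta_ij X_ij + \sum_i alpha_i x_i + gamma >= 0;
   only the strictly upper triangular entries of beta are meaningful. *)
Record cut (n : nat) := Cut {
  cut_alpha : 'cV[int]_n;
  cut_beta : 'M[int]_n;
  cut_gamma : int }.

Definition ECG (R : realType) (n : nat) (v0 : R) (v : 'cV[R]_n) : cut n :=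
  {| cut_alpha := \col_i Num.ceil (v i 0 ^+ 2 + 2 * v i 0 * v0);
     cut_beta := \matrix_(i, j)
       (if (i < j)%N then Num.ceil (2 * v i 0 * v j 0) else 0);
     cut_gamma := Num.floor (v0 ^+ 2) |}.

Definition F2_params (R : realType) (n : nat) (v0 : R) (v : 'cV[R]_n) : Prop :=
  [/\ forall i, v i 0 ^+ 2 \is a Num.int,
      forall i j, i != j -> 2 * v i 0 * v j 0 \is a Num.int
    & forall i, 2 * v i 0 * v0 \is a Num.int].

(* Writing the cut as a^T z <= b, with a = (-alpha, -beta) and b = gamma, this
   is (a^T z - b) / ||a||_2 at z = (x, X). *)
Definition depth (R : realType) (n : nat) (c : cut n)
    (x : 'cV[R]_n) (X : 'M[R]_n) : R :=
  (- (cut_gamma c)%:~R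
   - \sum_(i < n) \sum_(j < n | (i < j)%N) (cut_beta c i j)%:~R * X i j
   - \sum_(i < n) (cut_alpha c i 0)%:~R * x i 0)
  / Num.sqrt (\sum_(i < n) \sum_(j < n | (i < j)%N) (cut_beta c i j)%:~R ^+ 2
              + \sum_(i < n) (cut_alpha c i 0)%:~R ^+ 2).

Definition norm0 (R : realType) (n : nat) (v : 'cV[R]_n) : nat :=
  #|[set i | v i 0 != 0]|%SET.

Definition norm2 (R : realType) (n : nat) (v : 'cV[R]_n) : R :=
  Num.sqrt (\sum_i v i 0 ^+ 2).

(* Main.v *)
Require Import Defs.
From HB Require Import structures.
From mathcomp Require Import all_boot all_order all_algebra.
From mathcomp Require Import classical_sets reals.
From mathcomp Require Import ring lra.
Set Implicit Arguments.
Unset Strict Implicit.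
Unset Printing Implicit Defensive.
Import Order.TTheory GRing.Theory Num.Theory.
Local Open Scope ring_scope.

(** Write S for the squared norm of v and k for its number of nonzero entries.

    The numerator of the depth is below 1. The integrality conditions make the
    roundings in alpha and beta trivial, so only the rounding of v0^2 loses
    anything. Evaluating the positive semidefinite matrix of the relaxation at
    (v0, v) gives [sdp_quadratic_ge0]; since X_ii <= x_i, the diagonal terms
    v_i^2 X_ii may be replaced by v_i^2 x_i, which yields the inequality
    sum beta_ij X_ij + sum alpha_i x_i + v0^2 >= 0. Passing from v0^2 to its
    floor makes the violation at most the fractional part of v0^2.

    The denominator is large. Its square is at least
    sum_(i < j) (2 v_i v_j)^2 = 2 sum_i v_i^2 (sum_(j != i) v_j^2), and each
    inner sum is at least k - 1 because the nonzero v_j^2 are positive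
    integers. Hence the square is at least 2 (k - 1) S ([sum_sq_products_ge]),
    which is more than (k - 1) S. *)

Lemma sum_offdiag (V : zmodType) (n : nat) (F : 'I_n -> 'I_n -> V) :
  (forall i j, F i j = F j i) ->
  \sum_i \sum_(j | j != i) F i j
    = (\sum_(i < n) \sum_(j < n | (i < j)%N) F i j) *+ 2.
Proof.
move=> Fsym; rewrite mulr2n.
rewrite [X in _ = _ + X](exchange_big_dep predT) //= -big_split /=.
apply: eq_bigr => i _.
rewrite (bigID (fun j : 'I_n => (i < j)%N)) /=; congr (_ + _).
  apply: eq_bigl => j; rewrite andbC; case: (ltngtP i j) => //= ij.
  by rewrite -val_eqE /= gtn_eqF.
apply: eq_big => [j|j _ //]; rewrite -val_eqE /=.
by case: (ltngtP i j).
Qed.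

Lemma quadratic_form_sum (R : comNzRingType) (n : nat) (A : 'M[R]_n)
    (u : 'cV[R]_n) :
  (u^T *m A *m u) 0 0 = \sum_i \sum_j u i 0 * u j 0 * A i j.
Proof.
rewrite mxE exchange_big /=; apply: eq_bigr => j _.
rewrite mxE mulr_suml; apply: eq_bigr => i _.
by rewrite mxE mulrAC.
Qed.

(** The quadratic form of the block matrix at (v0, v), chosen because the cut
    is the rounding of (v0 + sum_i v_i x_i)^2 >= 0 expanded with x_i^2 = x_i. *)
Lemma sdp_quadratic_ge0 (R : realType) (n : nat) (v0 : R) (v x : 'cV[R]_n)
    (X : 'M[R]_n) :
  sdp_constraint x X ->
  0 <= v0 ^+ 2 + 2 * v0 * (\sum_i v i 0 * x i 0)
       + \sum_i \sum_j v i 0 * v j 0 * X i j.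
Proof.
case=> _ /(_ (col_mx v0%:M v)).
rewrite tr_col_mx mul_row_block mul_row_col tr_scalar_mx mulmx1.
rewrite !mulmxDl -!scalar_mxM !mul_scalar_mx.
have -> : v^T *m x *m v0%:M = v0 *: (v^T *m x) by rewrite mul_mx_scalar.
rewrite -scalemxAl.
have -> : x^T *m v = v^T *m x.
  by apply/matrixP=> i j; rewrite !mxE; apply: eq_bigr => k _;
     rewrite !mxE !ord1 mulrC.
rewrite !mxE -quadratic_form_sum.
have -> : \sum_j v^T 0 j * x j 0 = \sum_i v i 0 * x i 0.
  by apply: eq_bigr => i _; rewrite mxE.
rewrite mxE eqxx mulr1n; lra.
Qed.

(** Each nonzero v_j^2 is a positive integer, hence at least 1, and leaving out
    the index i loses at most one nonzero entry. *)
Lemma norm0_sub1_le (R : realType) (n : nat) (v : 'cV[R]_n) (i : 'I_n) :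
  (forall j, v j 0 ^+ 2 \is a Num.int) ->
  (norm0 v)%:R - 1 <= \sum_(j | j != i) v j 0 ^+ 2.
Proof.
move=> v2int; rewrite lerBlDr addrC.
have -> : (norm0 v)%:R = \sum_j (v j 0 != 0)%:R :> R.
  rewrite /norm0 -sum1_card natr_sum big_mkcond /=.
  by apply: eq_bigr => j _; rewrite inE; case: (v j 0 != 0).
rewrite (bigD1 i) //=; apply: lerD.
  by case: (v i 0 != 0); rewrite ?ler01.
apply: ler_sum => j _; have [->|vj0] := eqVneq (v j 0) 0.
  by rewrite expr0n.
have := norm_intr_ge1 (v2int j); rewrite sqrf_eq0 vj0 => /(_ isT).
by rewrite ger0_norm ?sqr_ge0.
Qed.

(** Symmetrizing turns the sum into
    2 sum_i v_i^2 (sum_(j != i) v_j^2), whose inner sums are bounded below by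
    [norm0_sub1_le]. *)
Lemma sum_sq_products_ge (R : realType) (n : nat) (v : 'cV[R]_n) :
  (forall j, v j 0 ^+ 2 \is a Num.int) ->
  2 * (((norm0 v)%:R - 1) * \sum_i v i 0 ^+ 2)
    <= \sum_(i < n) \sum_(j < n | (i < j)%N) (2 * v i 0 * v j 0) ^+ 2.
Proof.
move=> v2int.
have -> : \sum_(i < n) \sum_(j < n | (i < j)%N) (2 * v i 0 * v j 0) ^+ 2
    = 2 * \sum_i v i 0 ^+ 2 * \sum_(j | j != i) v j 0 ^+ 2.
  transitivity ((\sum_(i < n) \sum_(j < n | (i < j)%N)
                    2 * (v i 0 ^+ 2 * v j 0 ^+ 2)) *+ 2).
    rewrite -sumrMnl; apply: eq_bigr => i _.
    by rewrite -sumrMnl; apply: eq_bigr => j _; ring.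
  rewrite -sum_offdiag => [|i j]; last by rewrite (mulrC (v i 0 ^+ 2)).
  rewrite mulr_sumr; apply: eq_bigr => i _.
  by rewrite !mulr_sumr; apply: eq_bigr.
rewrite ler_pM2l ?ltr0n // mulr_sumr; apply: ler_sum => i _.
by rewrite mulrC ler_wpM2l ?sqr_ge0 // norm0_sub1_le.
Qed.

(** Separates the diagonal, where v_i^2 X_ii is going to be compared with
    v_i^2 x_i, from the strictly upper triangular part that the cut keeps. *)
Lemma quadratic_form_split (R : realType) (n : nat) (v : 'cV[R]_n) (X : 'M[R]_n) :
  (forall i j, X i j = X j i) ->
  \sum_i \sum_j v i 0 * v j 0 * X i j
    = \sum_i v i 0 ^+ 2 * X i i
      + \sum_(i < n) \sum_(j < n | (i < j)%N) 2 * v i 0 * v j 0 * X i j.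
Proof.
move=> Xsym.
have -> : \sum_(i < n) \sum_(j < n | (i < j)%N) 2 * v i 0 * v j 0 * X i j
  = \sum_i \sum_(j | j != i) v i 0 * v j 0 * X i j.
  rewrite sum_offdiag => [|i j]; last by rewrite (mulrC (v i 0)) Xsym.
  rewrite -sumrMnl; apply: eq_bigr => i _.
  by rewrite -sumrMnl; apply: eq_bigr => j _; ring.
rewrite -big_split /=; apply: eq_bigr => i _.
by rewrite (bigD1 i) //= expr2.
Qed.

Theorem proposition7 (R : realType) (n : nat)
    (v0 : R) (v : 'cV[R]_n) (x : 'cV[R]_n) (X : 'M[R]_n)
    (hF2 : F2_params v0 v)
    (hv : (2 <= norm0 v)%N)
    (hX : X \is symmetricmx)
    (hQPB : ~ @QPB R n (x, X))
    (hSDP : sdp_constraint x X)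
    (hMC : forall i j : 'I_n, i != j -> mccormick x X i j)
    (hdiag : forall i : 'I_n, X i i <= x i 0) :
  depth (ECG v0 v) x X <= 1 / (Num.sqrt ((norm0 v)%:R - 1) * norm2 v).
Proof.
case: hF2 => v2int vvint vv0int.
have Xsym i j : X i j = X j i.
  by move/is_hermitianmxP/matrixP/(_ i j): hX; rewrite !mxE expr0 mul1r.
have alphaE i : (cut_alpha (ECG v0 v) i 0)%:~R = v i 0 ^+ 2 + 2 * v i 0 * v0.
  by rewrite mxE; apply/eqP; rewrite -intrEceil rpredD.
have betaE (i j : 'I_n) : (i < j)%N ->
    (cut_beta (ECG v0 v) i j)%:~R = 2 * v i 0 * v j 0.
  move=> ij; rewrite mxE ij; apply/eqP; rewrite -intrEceil vvint //.
  by rewrite -val_eqE ltn_eqF.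
rewrite /depth.
have -> : \sum_(i < n) \sum_(j < n | (i < j)%N)
              (cut_beta (ECG v0 v) i j)%:~R * X i j
        = \sum_(i < n) \sum_(j < n | (i < j)%N) 2 * v i 0 * v j 0 * X i j.
  by do 2!(apply: eq_bigr => ? ?); rewrite betaE.
have -> : \sum_(i < n) \sum_(j < n | (i < j)%N)
              (cut_beta (ECG v0 v) i j)%:~R ^+ 2
        = \sum_(i < n) \sum_(j < n | (i < j)%N) (2 * v i 0 * v j 0) ^+ 2 :> R.
  by do 2!(apply: eq_bigr => ? ?); rewrite betaE.
set N := (X in X / _ <= _); set D := (X in _ / Num.sqrt X <= _).
have k1_ge1 : 1 <= (norm0 v)%:R - 1 :> R.
  by rewrite lerBrDr -[1 + 1](natrD R 1 1) ler_nat.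
have k1_gt0 := lt_le_trans ltr01 k1_ge1.
have N_le1 : N <= 1.
  have := sdp_quadratic_ge0 v0 v hSDP; rewrite quadratic_form_split //.
  have : \sum_i v i 0 ^+ 2 * X i i <= \sum_i v i 0 ^+ 2 * x i 0.
    by apply: ler_sum => i _; rewrite ler_wpM2l ?sqr_ge0.
  have alphaxE : \sum_(i < n) (cut_alpha (ECG v0 v) i 0)%:~R * x i 0
      = \sum_i v i 0 ^+ 2 * x i 0 + 2 * v0 * (\sum_i v i 0 * x i 0) :> R.
    rewrite mulr_sumr -big_split /=; apply: eq_bigr => i _.
    by rewrite alphaE; ring.
  (* Only the constant term is truly rounded: floor (v0^2) > v0^2 - 1. *)
  have := floorD1_gt (v0 ^+ 2); rewrite intrD /N alphaxE [cut_gamma _]/=; lra.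
have S_gt0 : 0 < \sum_i v i 0 ^+ 2.
  rewrite lt_def sumr_ge0 => [|i _]; last exact: sqr_ge0.
  rewrite andbT psumr_neq0 => [|i _]; last exact: sqr_ge0.
  have /card_gt0P [i] : (0 < norm0 v)%N by apply: leq_trans hv.
  rewrite inE => vi0; apply/hasP; exists i; rewrite ?mem_index_enum //=.
  by rewrite lt_def sqrf_eq0 vi0 sqr_ge0.
have D_ge : ((norm0 v)%:R - 1) * \sum_i v i 0 ^+ 2 <= D.
  have := sum_sq_products_ge v2int; have := mulr_gt0 k1_gt0 S_gt0.
  have : 0 <= \sum_i (cut_alpha (ECG v0 v) i 0)%:~R ^+ 2 :> R.
    by apply: sumr_ge0 => i _; apply: sqr_ge0.
  by rewrite /D /=; lra.
have kS_gt0 := mulr_gt0 k1_gt0 S_gt0.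
have D_gt0 := lt_le_trans kS_gt0 D_ge.
rewrite /norm2 -sqrtrM ?(ltW k1_gt0) //.
apply: (@le_trans _ _ (1 / Num.sqrt D)).
  by rewrite ler_wpM2r // invr_ge0 sqrtr_ge0.
rewrite !div1r lef_pV2 ?posrE ?sqrtr_gt0 //.
by rewrite ler_sqrt // ltW.
Qed.
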